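(* Let $H$ be a graph and let $v_0$ be a vertex of $H$. Then the following two conditions are equivalent. (1) For any graph $G$, the graph $G[H;\{v_0\}]$ is well-covered and shellable. (2) $H$ is well-covered, both $H$ and $H \setminus \{v_0\}$ are shellable, and for any maximal independent set $\tau$ of $H \setminus \{v_0\}$ there exists $v \in \tau$ such that $\{v_0, v\} \in E(H)$.
   Context: All graphs are finite and simple: $G=(V(G),E(G))$ with $V(G)$ a finite set and $E(G)\subset\{e\subset V(G) : |e|=2\}$. A set $\sigma\subset V(G)$ is independent if $\{u,v\}\notin E(G)$ for all $u,v\in\sigma$. The independence complex $I(G)$ is the simplicial complex on $V(G)$ whose simplices are the independent sets of $G$. A graph is well-covered if all its maximal (with respect to inclusion) independent sets have the same cardinality. A simplicial complex $K$ is shellable (in the non-pure sense) if its facets (inclusion-maximal simplices) can be arranged in a linear order $F_1,\dots,F_t$ such that for all $k=2,\dots,t$ the subcomplex $\left(\bigcup_{i=1}^{k-1}\langle F_i\rangle\right)\cap\langle F_k\rangle$ is pure and $(\dim F_k-1)$-dimensional, where $\langle F\rangle$ is the complex of all subsets of $F$, $\dim F=|F|-1$, and pure means that all facets have the same cardinality. A graph is shellable if its independence complex is shellable. $H\setminus\{v_0\}$ is the induced subgraph of $H$ on $V(H)\setminus\{v_0\}$ (if $V(H)=\{v_0\}$ it is the graph with no vertices, whose independence complex is $\{\emptyset\}$). For graphs $G$, $H$ and $v_0\in V(H)$, $G[H;\{v_0\}]$ is the graph obtained from $G\sqcup\bigsqcup_{u\in V(G)}H_u$, where each $H_u$ is a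 copy of $H$, by identifying, for each $u\in V(G)$, the vertex $u$ of $G$ with the vertex $v_0$ of $H_u$. Equivalently, its vertex set is $V(G)\times V(H)$, and $(u_1,v_1),(u_2,v_2)$ are adjacent if and only if either $u_1=u_2$ and $\{v_1,v_2\}\in E(H)$, or $\{u_1,u_2\}\in E(G)$ and $v_1=v_2=v_0$. *)

(* Defs.v *)
From mathcomp Require Import all_boot all_order all_algebra.

Set Implicit Arguments.
Unset Strict Implicit.
Unset Printing Implicit Defensive.

(* The vertex set may be empty. *)
Record sgraph := SGraph {
  vertex :> finType;
  edge : rel vertex;
  edge_sym : symmetric edge;
  edge_irrefl : irreflexive edge }.

Section SimplicialComplexes.
Variable V : finType.
Implicit Types (F : {set V}) (K : {set {set V}}).

(* A simplicial complex on V is given by the set K of its simplices, the empty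
   simplex included, so that <F> = powerset F and unions and intersections of
   complexes are those of {set {set V}}. *)

Definition facets K : {set {set V}} := [set F | maxset (mem K) F].

Definition pure K : Prop := {in facets K &, forall F F', #|F| = #|F'|}.

(* Dimensions are integers because the empty simplex has dimension -1. *)
Definition sdim F : int := (#|F|%:Z - 1)%R.

Definition cdim K : int := ((\max_(F in K) #|F|)%:Z - 1)%R.

(* Nonpure shellability; the facet F_(k+1) is nth set0 Fs k. *)
Definition shelling K (Fs : seq {set V}) : Prop :=
  perm_eq Fs (enum (facets K)) /\
  forall k, 0 < k < size Fs ->
    let L := (\bigcup_(i < k) powerset (nth set0 Fs i))
               :&: powerset (nth set0 Fs k) in
    pure L /\ cdim L = (sdim (nth set0 Fs k) - 1)%R.

Definition shellable_complex K : Prop := exists Fs, shelling K Fs.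

End SimplicialComplexes.

Section Graphs.
Variable G : sgraph.

Definition independent (A : {set G}) : bool :=
  [forall u in A, forall v in A, ~~ edge u v].

Definition indep_complex : {set {set G}} := [set A | independent A].

Definition max_independent (A : {set G}) : bool := maxset independent A.

Definition well_covered : Prop :=
  forall A B : {set G}, max_independent A -> max_independent B -> #|A| = #|B|.

Definition shellable : Prop := shellable_complex indep_complex.

End Graphs.

Section Induced.
Variables (G : sgraph) (S : {set G}).

Definition induced_edge : rel {x : G | x \in S} :=
  fun x y => edge (val x) (val y).

Lemma induced_edge_sym : symmetric induced_edge.
Proof. by move=> x y; rewrite /induced_edge edge_sym. Qed.

Lemma induced_edge_irrefl : irreflexive induced_edge.
Proof. by move=> x; rewrite /induced_edge edge_irrefl. Qed.

Definition induced : sgraph := SGraph induced_edge_sym induced_edge_irrefl.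

End Induced.

Definition del_vertex (G : sgraph) (v : G) : sgraph := induced [set~ v].

Section Attach.
Variables (G H : sgraph) (v0 : H).

(* The pair (u, v) is the vertex v of the copy H_u of H; the vertex u of G is
   identified with (u, v0). *)
Definition attach_edge : rel (G * H)%type := fun x y =>
  ((x.1 == y.1) && edge x.2 y.2) ||
  [&& edge x.1 y.1, x.2 == v0 & y.2 == v0].

Lemma attach_edge_sym : symmetric attach_edge.
Proof.
move=> x y; rewrite /attach_edge eq_sym (edge_sym x.2) (edge_sym x.1).
by rewrite (andbC (x.2 == v0)).
Qed.

Lemma attach_edge_irrefl : irreflexive attach_edge.
Proof. by move=> x; rewrite /attach_edge !edge_irrefl andbF. Qed.

(* The graph G[H; {v0}]. *)
Definition attach : sgraph := SGraph attach_edge_sym attach_edge_irrefl.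

End Attach.

(* Main.v *)
(* Shellability amounts to a ranking of the facets such that, whenever A <> B
   and rk A <= rk B, some facet C of rank less than rk B contains all of B but
   one vertex, which lies outside A.  This passes to links at once.

   (1) => (2): for G a point, G[H; {v0}] is H.  For G the path with three
   vertices, let X be a maximal independent set of H containing v0 and Y one of
   H \ {v0}.  Placing X on the leaves and Y on the center, or the opposite,
   gives two maximal independent sets, so 2|X| + |Y| = 2|Y| + |X| and |X| = |Y|;
   hence Y + v0 is not independent.  The link of the two copies of X at the
   leaves is the independence complex of H \ {v0}.

   (2) => (1): maximal independent sets of H \ {v0} are maximal in H, so a facet
   of G[H; {v0}] is a family of facets of H, indexed by G, whose members
   containing v0 sit over an independent set of G.  Rank the facets of H so that
   those avoiding v0 come first, as in a shelling of H \ {v0}, followed by those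
   containing v0, as in a shelling of H.  Rank families by the sum of the ranks:
   a family is improved by lowering the rank of a single member, which never
   introduces v0. *)
Require Import Defs.
From mathcomp Require Import all_boot all_order all_algebra.

Set Implicit Arguments.
Unset Strict Implicit.
Unset Printing Implicit Defensive.

(** * Shellings as rankings of facets *)

Section ShellingRank.
Variable V : finType.
Implicit Types (A B C F M : {set V}) (K Fs : {set {set V}}).

(* Ties between distinct facets are allowed, so that a rank need not come from
   a linear order; [B :\: C = [set x]] with [x \notin A] says that
   [A :&: B \subset C :&: B] and that [C :&: B] has codimension one in [B]. *)
Definition shelling_rank Fs (rk : {set V} -> nat) : Prop :=
  {in Fs &, forall A B, A != B -> rk A <= rk B ->
     exists C x, [/\ C \in Fs, rk C < rk B, B :\: C = [set x] & x \notin A]}.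

Lemma cdim_facet K A : A \in K -> exists2 F, F \in facets K & cdim K = sdim F.
Proof.
move=> AK; have K0 : 0 < #|K| by apply/card_gt0P; exists A.
have [F FK maxF] := eq_bigmax_cond (fun F : {set V} => #|F|) K0.
exists F; last by rewrite /cdim maxF.
rewrite inE; apply/maxsetP; split=> // B BK FB.
by apply/eqP; rewrite eq_sym eqEcard FB -maxF leq_bigmax_cond.
Qed.

Lemma sdim_succ A B : sdim A = (sdim B - 1)%R <-> #|A|.+1 = #|B|.
Proof.
rewrite /sdim; split=> [/GRing.addIr eqAB | <-].
  by apply/eqP; rewrite -eqz_nat -addn1 PoszD eqAB GRing.subrK.
by rewrite -addn1 PoszD GRing.addrK.
Qed.

(** Positions in a shelling serve as ranks. Conversely, sort the facets by rank, ties in any order: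
    each facet of the complex where [B] meets the earlier facets is the trace on [B] of an earlier
    [C] that misses one vertex of [B]. *)
Lemma shellable_rank K :
  shellable_complex K <-> exists rk, shelling_rank (facets K) rk.
Proof.
split=> [[Fs [permFs shFs]] | [rk rkP]].
  have memFs : Fs =i facets K by move=> F; rewrite (perm_mem permFs) mem_enum.
  exists (fun A => index A Fs) => A B AK BK neqAB leAB.
  have ltAB : index A Fs < index B Fs.
    rewrite ltn_neqAle leAB andbT; apply: contra neqAB => /eqP.
    by move/index_inj ->; rewrite ?memFs.
  have ltB : index B Fs < size Fs by rewrite index_mem memFs.
  have /= := shFs (index B Fs); rewrite (leq_ltn_trans _ ltAB) // ltB.
  rewrite nth_index ?memFs //; set L := _ :&: _ => -[] // pureL dimL.
  have memL i : i < index B Fs -> nth set0 Fs i :&: B \in L.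
    move=> lti; rewrite !inE subsetIr andbT; apply/bigcupP.
    by exists (Ordinal lti) => //; rewrite inE subsetIl.
  have ABL : A :&: B \in L.
    by rewrite -(nth_index set0 (s := Fs) (x := A)) ?memFs ?memL.
  have [F FL dimF] := cdim_facet ABL.
  (* By purity and the dimension condition, a facet [M] of [L] containing [A :&: B] has codimension
     one in [B]. It is the trace on [B] of an earlier facet [C], and the vertex of [B] missing from
     [C] cannot lie in [A]. *)
  have [M maxM ABM] := maxset_exists (P := mem L) ABL.
  have FM : #|M| = #|F| by apply: pureL; rewrite // inE.
  have cardM : #|M|.+1 = #|B|.
    by rewrite FM; apply/sdim_succ; rewrite -dimF.
  have ML : M \in L := maxsetp maxM.
  move: (ML); rewrite !inE => /andP[/bigcupP[j _ Mj] MB].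
  have {}Mj : nth set0 Fs j :&: B = M.
    apply: (maxsetsup maxM); first exact: memL.
    by move: Mj; rewrite subsetI MB andbT inE.
  set C := nth set0 Fs j in Mj.
  have ltj : j < size Fs := ltn_trans (ltn_ord j) ltB.
  have /cards1P[x xE] : #|B :\: C| == 1.
    by rewrite -(eqn_add2l #|B :&: C|) cardsID setIC Mj addn1 cardM.
  exists C, x; split; rewrite // -?memFs ?mem_nth //.
    by apply: leq_ltn_trans (ltn_ord j); rewrite leqNgt;
      apply/negP=> /(before_find set0) /=; rewrite eqxx.
  have : x \in B :\: C by rewrite xE set11.
  rewrite inE => /andP[xC xB]; apply: contra xC => xA.
  have : x \in M by rewrite (subsetP ABM) // inE xA.
  by rewrite -Mj inE => /andP[].
pose leR A B := rk A <= rk B.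
pose Fs := sort leR (enum (facets K)).
have memFs : Fs =i facets K by move=> F; rewrite mem_sort mem_enum.
have uniqFs : uniq Fs by rewrite sort_uniq enum_uniq.
have sortFs : sorted leR Fs by apply: sort_sorted => A B; apply: leq_total.
have leFs i k : i <= k -> k < size Fs -> leR (nth set0 Fs i) (nth set0 Fs k).
  move=> ik kFs; apply: sorted_leq_nth => //.
  - by move=> A B C; apply: leq_trans.
  - by move=> A; apply: leqnn.
  - by rewrite inE (leq_ltn_trans ik).
exists Fs; split=> [|k /andP[k0 kFs]]; first by rewrite perm_sort.
set B := nth set0 Fs k; move=> L.
have cardL M : M \in facets L -> #|M|.+1 = #|B|.
  rewrite inE => maxM; move: (maxsetp maxM).
  rewrite !inE => /andP[/bigcupP[i _ Mi] MB].
  have [||||C [x [CK ltC xE xA]]] := rkP (nth set0 Fs i) B.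
  - by rewrite -memFs mem_nth // (ltn_trans (ltn_ord i)).
  - by rewrite -memFs mem_nth.
  - by rewrite nth_uniq ?(ltn_trans (ltn_ord i)) // neq_ltn ltn_ord.
  - exact/leFs/kFs/ltnW/ltn_ord.
  (* Sorting is only weak, but the rank of [C] is strictly smaller, so [C] precedes [B] despite
     ties. *)
  have ltCk : index C Fs < k.
    rewrite ltnNge; apply/negP => kC.
    have := leFs _ _ kC; rewrite index_mem nth_index memFs // => /(_ CK).
    by rewrite /leR leqNgt ltC.
  have MC : C :&: B = M.
    apply: (maxsetsup maxM).
      rewrite !inE subsetIr andbT; apply/bigcupP.
      by exists (Ordinal ltCk); rewrite // inE nth_index ?subsetIl ?memFs.
    (* The only vertex of [B] outside [C] is [x], which is not in [M] because [M] lies in the facet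
       of index [i]. *)
    rewrite subsetI MB andbT; apply/subsetP=> y yM; apply: contraNT xA => yC.
    have : y \in B :\: C by rewrite inE yC (subsetP MB).
    rewrite xE inE => /eqP <-; move: Mi; rewrite inE => /subsetP; exact.
  by rewrite -MC setIC -addn1 -(cards1 x) -xE cardsID.
split=> [M N ML NL|]; first by apply: succn_inj; rewrite !cardL.
(* Since [k > 0], [L] is nonempty, so its dimension is attained at a facet rather than being the
   default value of an empty maximum. *)
have L0 : set0 \in L.
  rewrite !inE sub0set andbT; apply/bigcupP.
  by exists (Ordinal k0); rewrite // inE sub0set.
by have [F /cardL FL ->] := cdim_facet L0; apply/sdim_succ.
Qed.

End ShellingRank.

(* With [S] a face, this passes from a complex to the link of [S]. *)
Lemma shelling_rank_pullback (V W : finType) (Fs : {set {set V}})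
    (Fs' : {set {set W}}) (rk : {set V} -> nat) (g : W -> V) (S : {set V}) :
    injective g -> (forall y, g y \notin S) ->
    {in Fs', forall A : {set W}, S :|: g @: A \in Fs} ->
    {in Fs, forall C : {set V}, S \subset C ->
       exists2 C', C' \in Fs' & C = S :|: g @: C'} ->
  shelling_rank Fs rk -> shelling_rank Fs' (fun A => rk (S :|: g @: A)).
Proof.
move=> injg gS Fs'Fs FsFs' rkP A B AF BF neqAB leAB.
have memg y (D : {set W}) : (g y \in S :|: g @: D) = (y \in D).
  by rewrite in_setU (negbTE (gS y)) mem_imset.
have [||||C [x [CF ltC xE xA]]] := rkP (S :|: g @: A) (S :|: g @: B).
- exact: Fs'Fs.
- exact: Fs'Fs.
- by apply: contra neqAB => /eqP eqf; apply/eqP/setP=> y; rewrite -2!memg eqf.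
- exact: leAB.
have [|C' C'F defC] := FsFs' C CF.
  (* Passing to [C] loses only [x], which is outside [S :|: g @: A], so [S] is kept. *)
  apply/subsetP=> z zS; apply: contraNT xA => zC.
  have : z \in (S :|: g @: B) :\: C by rewrite !inE zC zS.
  by rewrite xE inE => /eqP <-; rewrite inE zS.
have : x \in (S :|: g @: B) :\: C by rewrite xE set11.
rewrite inE => /andP[_]; rewrite inE => /orP[xS | /imsetP[y yB def_x]].
  by rewrite inE xS in xA.
exists C', y; split; rewrite -?defC -?(memg _ A) -?def_x //.
apply/setP=> z; rewrite !inE -(inj_eq injg) -def_x.
by move/setP/(_ (g z)): xE; rewrite defC in_setD !memg in_set1.
Qed.

(** * Independent sets of H and of H \ {v0} *)

Lemma independentP (G : sgraph) (A : {set G}) :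
  reflect {in A &, forall u v, ~~ edge u v} (independent A).
Proof.
apply: (iffP forall_inP) => indA u.
  by move=> v uA vA; move/forall_inP: (indA u uA); apply.
by move=> uA; apply/forall_inP=> v /(indA u v uA).
Qed.

Lemma independentS (G : sgraph) (A B : {set G}) :
  A \subset B -> independent B -> independent A.
Proof.
by move=> /subsetP AB /independentP indB; apply/independentP=> u v /AB uB /AB;
  apply: indB.
Qed.

Lemma facets_indep (G : sgraph) (A : {set G}) :
  (A \in facets (indep_complex G)) = max_independent A.
Proof. by rewrite inE; apply: maxset_eq => B; rewrite !inE. Qed.

Section Avoiding.
Variables (H : sgraph) (v0 : H).
Implicit Types (X : {set H}) (A : {set del_vertex v0}).

(** The flag interpolates between two complexes on the same vertex type: [false] gives the
    independent sets of H, [true] those of H \ {v0}. In a family indexed by G it records whether a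
    neighbouring copy uses its [v0]. *)
Definition avoiding (b : bool) X := independent X && ((v0 \in X) ==> ~~ b).

Lemma avoiding_false X : avoiding false X = independent X.
Proof. by rewrite /avoiding implybT andbT. Qed.

Lemma avoidingS (b b' : bool) X :
  (v0 \in X -> b' -> b) -> avoiding b X -> avoiding b' X.
Proof.
by move=> bb' /andP[indX]; rewrite /avoiding indX;
  case: (v0 \in X) bb' => //= bb'; apply/contra/bb'.
Qed.

Lemma maxset_avoiding_false X : maxset (avoiding false) X = max_independent X.
Proof. exact/maxset_eq/avoiding_false. Qed.

Lemma exists_max_independent1 : exists2 X, max_independent X & v0 \in X.
Proof.
have [|X maxX v0X] := @maxset_exists _ (@independent H) [set v0].
  by apply/independentP=> u v /set1P -> /set1P ->; rewrite edge_irrefl.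
by exists X; rewrite // -sub1set.
Qed.

Lemma v0_notin_imset_val A : v0 \notin val @: A.
Proof.
by apply/imsetP=> -[x _ v0x]; have := valP x; rewrite -v0x !inE eqxx.
Qed.

Lemma imset_val_preim X : v0 \notin X ->
  val @: (val @^-1: X : {set del_vertex v0}) = X.
Proof.
move=> v0X; apply/setP=> x; apply/imsetP/idP => [[y yX ->]|xX];
  first by rewrite inE in yX.
have xv0 : x \in [set~ v0] by rewrite !inE; apply: contraNneq v0X => <-.
by exists (Sub x xv0); rewrite ?inE.
Qed.

Lemma independent_del A : independent A = avoiding true (val @: A).
Proof.
rewrite /avoiding (negbTE (v0_notin_imset_val A)) andbT.
apply/independentP/independentP => indA x y.
  by move=> /imsetP[u uA ->] /imsetP[v vA ->]; apply: indA.
by move=> xA yA; apply: indA; apply: imset_f.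
Qed.

Lemma max_independent_del A :
  max_independent A = maxset (avoiding true) (val @: A).
Proof.
apply/maxsetP/maxsetP=> -[indA maxA].
  split=> [|B avB AB]; first by rewrite -independent_del.
  have v0B : v0 \notin B by case/andP: avB; case: (v0 \in B).
  suff <- : val @^-1: B = A by rewrite imset_val_preim.
  apply: maxA.
    by rewrite independent_del imset_val_preim.
  by rewrite -sub_imset_pre.
split=> [|B]; first by rewrite independent_del.
rewrite independent_del => avB AB; apply: (imset_inj val_inj).
by apply: maxA; rewrite // imsetS.
Qed.

End Avoiding.

(** * Vertex sets of G[H; {v0}] as families of subsets of H *)

Section Glue.
Variables (G H : sgraph) (v0 : H).
Implicit Types (F : G -> {set H}) (A : {set attach G v0}).

Definition glue F : {set attach G v0} := [set p : G * H | p.2 \in F p.1].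

Definition slice A (u : G) : {set H} := [set v | (u, v) \in A].

Definition blocked F (u : G) := [exists w, edge u w && (v0 \in F w)].

Lemma mem_glue F u v : ((u, v) \in glue F) = (v \in F u).
Proof. by rewrite inE. Qed.

Lemma slice_glue F : slice (glue F) =1 F.
Proof. by move=> u; apply/setP=> v; rewrite !inE. Qed.

Lemma glue_slice A : glue (slice A) = A.
Proof. by apply/setP=> -[u v]; rewrite !inE. Qed.

Lemma card_glue F : #|glue F| = \sum_u #|F u|.
Proof.
rewrite -sum1_card.
rewrite (eq_bigl (fun p : G * H => true && (p.2 \in F p.1))) => [|p].
  rewrite -(pair_big_dep xpredT (fun u v => v \in F u) (fun _ _ => 1)) /=.
  by apply: eq_bigr => u _; rewrite sum1_card.
by rewrite inE.
Qed.

Lemma independent_glue F :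
  independent (glue F) = [forall u, avoiding v0 (blocked F u) (F u)].
Proof.
apply/independentP/forallP => [indF u | avF [u v] [w z]].
  apply/andP; split.
    apply/independentP=> v w vF wF; have := indF (u, v) (u, w).
    by rewrite !mem_glue vF wF /edge/= /attach_edge /= eqxx =>
      /(_ isT isT) /norP[].
  apply/implyP=> v0F; apply/existsP=> -[w /andP[uw v0Fw]].
  have := indF (u, v0) (w, v0); rewrite !mem_glue => /(_ v0F v0Fw).
  by rewrite /edge/= /attach_edge /= uw !eqxx orbT.
rewrite !mem_glue => vF zF; rewrite /edge/= /attach_edge /=; apply/norP; split.
  apply/andP=> -[/eqP uw]; apply/negP; rewrite -uw in zF.
  by have /andP[/independentP indF _] := avF u; apply: indF.
apply/and3P=> -[uw /eqP vv0 /eqP zv0]; rewrite vv0 in vF; rewrite zv0 in zF.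
have /andP[_] := avF u; rewrite vF => /existsP[]; exists w; by rewrite uw.
Qed.

(** Maximality can be tested one copy at a time, the other members being fixed, because copies
    interact only through [v0]. *)
Lemma max_independent_glue F :
  max_independent (glue F) =
  [forall u, maxset (avoiding v0 (blocked F u)) (F u)].
Proof.
apply/maxsetP/forallP => [[indF maxF] u | maxF].
  rewrite independent_glue in indF; have /forallP avF := indF.
  apply/maxsetP; split=> // X /andP[indX v0X] FX.
  pose F' w := if w == u then X else F w.
  have FF' w : F w \subset F' w by rewrite /F'; case: eqP => // ->.
  have <- : F' u = F u; last by rewrite /F' eqxx.
  rewrite -slice_glue (maxF (glue F')) ?slice_glue //; last first.
    by apply/subsetP=> -[w v]; rewrite !mem_glue; apply/subsetP.
  rewrite independent_glue; apply/forallP=> w; rewrite {2}/F'.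
  have [-> | neqwu] := eqVneq w u.
    apply: (@avoidingS _ _ (blocked F u)) => [_|];
      last by rewrite /avoiding indX.
    case/existsP=> z; rewrite /F'; have [-> | neqzu] := eqVneq z u.
      by rewrite edge_irrefl.
    by move=> uz; apply/existsP; exists z.
  (* Replacing [F u] by [X] could newly block [w] only if [v0 \in X]; then [u] is not blocked by
     [F], so its neighbour [w] does not use [v0]. *)
  apply: avoidingS (avF w) => v0Fw /existsP[z]; rewrite /F'.
  have [-> | neqzu] := eqVneq z u; last by move=> uz; apply/existsP; exists z.
  case/andP=> wu v0Xu; move: v0X; rewrite v0Xu => /existsP[]; exists w.
  by rewrite edge_sym wu.
split=> [|B]; first by rewrite independent_glue; apply/forallP=> u;
  apply: maxsetp.
rewrite -[B]glue_slice independent_glue => /forallP avB /subsetP FB.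
have {}FB u : F u \subset slice B u.
  by apply/subsetP=> v vF; rewrite -mem_glue FB ?mem_glue.
apply/setP=> -[u v]; rewrite !mem_glue.
suff -> : slice B u = F u by [].
(* A larger family blocks at least as much, so its slices still obey the constraints set by [F]. *)
apply: (maxsetsup (maxF u)) => //; apply: avoidingS (avB u) => _.
by case/existsP=> w /andP[uw v0F]; apply/existsP; exists w;
  rewrite uw (subsetP (FB w)).
Qed.

End Glue.

(** * Necessity: G a point, G a path with three vertices *)

Definition point : sgraph :=
  @SGraph unit (fun _ _ => false) (fun _ _ => erefl) (fun _ => erefl).

(* The path on three vertices, with center [None] and leaves [Some _]. *)
Definition path3 : sgraph :=
  @SGraph (option bool) (fun x y => isSome x (+) isSome y)
    (fun _ _ => addbC _ _) (fun _ => addbb _).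

Section Necessity.
Variables (H : sgraph) (v0 : H).
Implicit Types X Y : {set H}.

Lemma max_independent_point X :
  max_independent (glue v0 (fun _ : point => X)) = max_independent X.
Proof.
have unblocked u : blocked v0 (fun _ : point => X) u = false.
  by apply/existsP=> -[].
rewrite max_independent_glue; apply/forallP/idP => [/(_ tt) | maxX u].
  by rewrite unblocked maxset_avoiding_false.
by rewrite unblocked maxset_avoiding_false.
Qed.

Lemma well_covered_point : well_covered (attach point v0) -> well_covered H.
Proof.
move=> wc X Y; rewrite -max_independent_point -(max_independent_point Y) =>
  maxX maxY.
have := wc _ _ maxX maxY.
by rewrite !card_glue !(big_pred1 tt) //; case.
Qed.

Lemma shellable_point : shellable (attach point v0) -> shellable H.
Proof.
move=> /shellable_rank[rk rkP]; apply/shellable_rank.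
pose g v : attach point v0 := (tt, v).
have gE X : set0 :|: g @: X = glue v0 (fun _ : point => X).
  rewrite set0U; apply/setP=> -[[] v]; rewrite mem_glue.
  by rewrite (mem_imset (f := g)) // => ? ? [].
exists (fun A : {set H} => rk (set0 :|: g @: A));
  apply: shelling_rank_pullback rkP.
- by move=> ? ? [].
- by move=> v; rewrite inE.
- by move=> A; rewrite gE !facets_indep max_independent_point.
move=> C; have CE : C = glue v0 (fun _ : point => slice C tt).
  by apply/setP=> -[[] v]; rewrite mem_glue inE.
by rewrite {1}CE !facets_indep max_independent_point => maxC _;
  exists (slice C tt); rewrite ?facets_indep ?gE.
Qed.

Definition leaves_center X Y (u : path3) := if isSome u then X else Y.

Lemma blocked_center X Y : blocked v0 (leaves_center X Y) None = (v0 \in X).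
Proof.
apply/existsP/idP => [[[b|]] // | v0X].
by exists (Some true).
Qed.

Lemma blocked_leaf X Y b : blocked v0 (leaves_center X Y) (Some b) = (v0 \in Y).
Proof.
apply/existsP/idP => [[[c|]] // | v0Y].
by exists None.
Qed.

Lemma max_independent_path3 X Y :
  max_independent (glue v0 (leaves_center X Y)) =
  maxset (avoiding v0 (v0 \in Y)) X && maxset (avoiding v0 (v0 \in X)) Y.
Proof.
rewrite max_independent_glue; apply/forallP/andP => [maxF | [maxX maxY] [b|]].
- by have:= maxF None; have := maxF (Some true);
    rewrite blocked_center blocked_leaf.
- by rewrite blocked_leaf.
- by rewrite blocked_center.
Qed.

Lemma maxset_avoiding_notin Y :
  maxset (avoiding v0 true) Y -> (v0 \in Y) = false.
Proof. by move/maxsetp/andP=> -[_]; case: (v0 \in Y). Qed.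

Lemma shellable_path3 :
  shellable (attach path3 v0) -> shellable (del_vertex v0).
Proof.
move=> /shellable_rank[rk rkP]; apply/shellable_rank.
(* With [v0 \in X] on the leaves, the center is blocked, which leaves exactly the independent sets
   of H \ {v0} there. *)
have [X maxX v0X] := exists_max_independent1 v0.
pose S : {set attach path3 v0} := glue v0 (leaves_center X set0).
pose g (v : del_vertex v0) : attach path3 v0 := (None, val v).
have injg : injective g by move=> ? ? [] /val_inj.
have gE (A : {set del_vertex v0}) :
  S :|: g @: A = glue v0 (leaves_center X (val @: A)).
  apply/setP=> -[[b|] v]; rewrite in_setU !mem_glue /=.
    by rewrite orbC; case: imsetP => // -[].
  rewrite inE; apply/imsetP/imsetP => -[y yA].
    by case=> ->; exists y.
  by move=> ->; exists y.
have maxS (A : {set del_vertex v0}) :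
    (S :|: g @: A \in facets (indep_complex (attach path3 v0))) =
      max_independent A.
  rewrite gE facets_indep max_independent_path3 v0X max_independent_del.
  by rewrite (negbTE (v0_notin_imset_val A)) maxset_avoiding_false maxX.
exists (fun A : {set del_vertex v0} => rk (S :|: g @: A));
  apply: shelling_rank_pullback rkP => //.
- by move=> v; rewrite mem_glue inE.
- by move=> A; rewrite maxS facets_indep.
move=> C CF SC; pose Y := slice C None.
have CE : C = glue v0 (leaves_center X Y).
  move: CF; rewrite facets_indep -{1}[C]glue_slice max_independent_glue =>
    /forallP maxC.
  apply/setP=> -[[b|] v]; rewrite mem_glue /= ?inE //.
  (* Over a leaf, [C] is an independent set containing [X], hence equal to [X] by maximality. *)
  suff <- : slice C (Some b) = X by rewrite inE.
  apply: (maxsetsup maxX); first by case/andP: (maxsetp (maxC (Some b))).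
  by apply/subsetP=> w wX; rewrite inE (subsetP SC) // mem_glue.
have v0Y : v0 \notin Y.
  move: CF; rewrite CE facets_indep max_independent_path3 => /andP[_].
  by rewrite v0X => /maxset_avoiding_notin ->.
have CS : C = S :|: g @: (val @^-1: Y : {set del_vertex v0}).
  by rewrite gE imset_val_preim.
by exists (val @^-1: Y); rewrite // facets_indep -maxS -CS.
Qed.

(** Both placements of [X] and [Y] are maximal: [v0 \in X] blocks the copies of [Y], while
    [v0 \notin Y] leaves those of [X] free. *)
Lemma well_covered_path3 :
    well_covered (attach path3 v0) ->
  forall X Y, max_independent X -> v0 \in X -> maxset (avoiding v0 true) Y ->
    #|X| = #|Y|.
Proof.
move=> wc X Y maxX v0X maxY; have v0Y := maxset_avoiding_notin maxY.
have cardE Z W : #|glue v0 (leaves_center Z W)| = #|W| + (#|Z| + #|Z|).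
  rewrite card_glue (bigD1 None) //= (bigD1 (Some true)) //=
    (bigD1 (Some false)) //=.
  by rewrite big_pred0 ?addn0 // => -[[]|].
have := wc (glue v0 (leaves_center X Y)) (glue v0 (leaves_center Y X)).
rewrite !max_independent_path3 v0X v0Y maxset_avoiding_false maxX maxY !cardE.
by move/(_ isT isT); rewrite addnCA => /addnI; rewrite addnC => /addIn.
Qed.

(** Otherwise adding [v0] to [tau] and extending to a maximal independent set of H would give one
    strictly larger than [tau]. *)
Lemma well_covered_edge :
    well_covered (attach path3 v0) ->
  forall tau : {set del_vertex v0}, max_independent tau ->
  exists2 v : del_vertex v0, v \in tau & edge v0 (val v).
Proof.
move=> wc tau; rewrite max_independent_del => maxtau.
apply/exists_inP; apply: contraT; rewrite negb_exists_in => /forall_inP notv0.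
have notin := v0_notin_imset_val tau.
set Y := val @: tau in maxtau notin.
have /andP[/independentP indY _] := maxsetp maxtau.
have v0Y y : y \in Y -> ~~ edge v0 y by case/imsetP=> v vtau ->; apply: notv0.
have indX : independent (v0 |: Y).
  apply/independentP=> x y /setU1P[-> | xY] /setU1P[-> | yY].
  - by rewrite edge_irrefl.
  - exact: v0Y.
  - by rewrite edge_sym v0Y.
  - exact: indY.
have [X maxX YX] := maxset_exists indX.
have := well_covered_path3 wc maxX (subsetP YX _ (setU11 _ _)) maxtau.
by have := subset_leq_card YX; rewrite cardsU1 notin => + XY; rewrite XY ltnn.
Qed.

End Necessity.

(** * Sufficiency: well-coveredness and shellability of G[H; {v0}] *)

Section Sufficiency.
Variables (H : sgraph) (v0 : H).
(** This is the form in which the condition on neighbours of [v0] is used. *)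
Hypothesis avoiding_max : forall X : {set H},
  maxset (avoiding v0 true) X -> max_independent X.

Lemma maxset_avoidingE b (X : {set H}) :
  maxset (avoiding v0 b) X = max_independent X && avoiding v0 b X.
Proof.
apply/idP/andP => [maxX | [/maxsetP[indX maxX] avX]].
  split; last exact: maxsetp maxX.
  by case: b maxX => [/avoiding_max|] //; rewrite maxset_avoiding_false.
by apply/maxsetP; split=> // Y /andP[indY _]; apply: maxX.
Qed.

Lemma max_independent_attach (G : sgraph) (F : G -> {set H}) :
  max_independent (glue v0 F) =
  [forall u, max_independent (F u) && avoiding v0 (blocked v0 F u) (F u)].
Proof.
rewrite max_independent_glue; apply: eq_forallb => u.
exact: maxset_avoidingE.
Qed.

Lemma well_covered_attach (G : sgraph) :
  well_covered H -> well_covered (attach G v0).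
Proof.
move=> wc A B; rewrite -[A]glue_slice -[B]glue_slice !max_independent_attach
  !card_glue.
move=> /forallP maxA /forallP maxB; apply: eq_bigr => u _; apply: wc.
  by case/andP: (maxA u).
by case/andP: (maxB u).
Qed.

(** The second conclusion is what lets a single member of a family be lowered in rank without
    blocking any new copy. *)
Lemma shelling_rank_v0_last :
    shellable H -> shellable (del_vertex v0) ->
  exists2 rk, shelling_rank (facets (indep_complex H)) rk &
    forall A B : {set H}, rk A <= rk B -> v0 \in A -> v0 \in B.
Proof.
move=> /shellable_rank[r1 r1P] /shellable_rank[r2 r2P].
pose r (A : {set H}) := r2 (val @^-1: A : {set del_vertex v0}).
(* The shift by [N] puts every set containing [v0] after all those avoiding it. *)
pose N := (\max_(A : {set H}) r A).+1.
have ltN A : r A < N by rewrite ltnS (leq_bigmax A).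
pose rk (A : {set H}) := if v0 \in A then N + r1 A else r A.
have rk_v0 A B : rk A <= rk B -> v0 \in A -> v0 \in B.
  move=> + v0A; rewrite /rk v0A; case: ifP => // _.
  by rewrite leqNgt (leq_trans (ltN B)) ?leq_addr.
exists rk => // A B; rewrite !facets_indep => maxA maxB neqAB leAB.
have [v0B | v0B] := boolP (v0 \in B); last first.
  have v0A := contra (rk_v0 _ _ leAB) v0B.
  have delP (D : {set H}) : v0 \notin D -> max_independent D ->
      (val @^-1: D : {set del_vertex v0}) \in
        facets (indep_complex (del_vertex v0)).
    move=> v0D maxD; rewrite facets_indep max_independent_del
      imset_val_preim //.
    by rewrite maxset_avoidingE maxD /avoiding (negbTE v0D) (maxsetp maxD).
  move: leAB; rewrite /rk (negbTE v0A) (negbTE v0B) => leAB.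
  have [||||C [x [CF ltC xE xA]]] := r2P (val @^-1: A) (val @^-1: B).
  - exact: delP.
  - exact: delP.
  - apply: contra neqAB => /eqP eqAB.
    by rewrite -(imset_val_preim v0A) eqAB imset_val_preim.
  - exact: leAB.
  have v0C := v0_notin_imset_val C.
  exists (val @: C), (val x); split.
  - by rewrite facets_indep avoiding_max // -max_independent_del -facets_indep.
  - rewrite (negbTE v0C) /r; suff -> : val @^-1: (val @: C) = C by [].
    by apply/setP=> y; rewrite inE mem_imset //; apply: val_inj.
  - rewrite -imset_set1 -xE; apply/setP=> y;
      apply/setDP/imsetP=> [[yB yC] | [z]].
      have /imsetP[z zB yz] : y \in val @: (val @^-1: B : {set del_vertex v0}).
        by rewrite imset_val_preim.
      exists z => //.
      by apply/setDP; split=> //; apply/negP=> zC; case/negP: yC; rewrite yz;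
        exact: imset_f zC.
    by rewrite !inE => /andP[zC zB] ->; split; rewrite // mem_imset //;
      apply: val_inj.
  - by rewrite inE in xA.
have [v0A | v0A] := boolP (v0 \in A).
  have [||||C [x [CF ltC xE xA]]] := r1P A B; rewrite ?facets_indep //.
    by move: leAB; rewrite /rk v0A v0B leq_add2l.
  (* The vertex lost is outside [A], so it is not [v0], and [C] is also in the shifted range. *)
  have v0C : v0 \in C.
    apply: contraNT xA => v0C; have : v0 \in B :\: C by rewrite inE v0C.
    by rewrite xE inE => /eqP <-.
  by exists C, x; split; rewrite // /rk v0C v0B ltn_add2l.
(* Here [v0] lies in [B] but not in [A], so it can be the vertex removed: extend [B :\ v0] within H
   \ {v0}. The result is a facet of H by [avoiding_max], and it ranks below [B]. *)
have [|C maxC BC] := @maxset_exists _ (avoiding v0 true) (B :\ v0).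
  rewrite /avoiding !inE eqxx andbT.
  exact: independentS (subD1set _ _) (maxsetp maxB).
have v0C : v0 \notin C by rewrite (maxset_avoiding_notin maxC).
exists C, v0; split=> //; first by rewrite facets_indep avoiding_max.
  by rewrite /rk v0B (negbTE v0C) (leq_trans (ltN C)) ?leq_addr.
apply/setP=> y; rewrite !inE; have [-> | neqy] := eqVneq y v0;
  first by rewrite v0C.
by apply: contraTF isT => /andP[yC yB]; rewrite (subsetP BC) ?inE ?neqy in yC.
Qed.

Lemma shellable_attach (G : sgraph) :
  shellable H -> shellable (del_vertex v0) -> shellable (attach G v0).
Proof.
move=> shH shD; have [rk rkP rk_v0] := shelling_rank_v0_last shH shD.
apply/shellable_rank; exists (fun A => \sum_u rk (slice A u)) => A B.
have sliceP (D : {set attach G v0}) : max_independent D -> forall u,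
    max_independent (slice D u) &&
    avoiding v0 (blocked v0 (slice D) u) (slice D u).
  by move=> maxD; apply/forallP; rewrite -max_independent_attach glue_slice.
rewrite !facets_indep => /sliceP maxA /sliceP maxB neqAB leAB.
(* If [B] had the smaller rank at every index where the families differ, its total rank would be
   strictly smaller than that of [A]. *)
have [u neqABu leABu] :
  exists2 u, slice A u != slice B u & rk (slice A u) <= rk (slice B u).
  apply/exists_inP; apply: contraLR leAB;
    rewrite negb_exists_in -ltnNge => /forall_inP ltBA.
  have [u neqABu] : exists u, slice A u != slice B u.
    apply/existsP; apply: contraNT neqAB; rewrite negb_exists => /forallP eqAB.
    apply/eqP/setP=> -[u v]; have /negPn/eqP/setP/(_ v) := eqAB u;
      by rewrite !inE.
  rewrite (bigD1 u) //= [ltnRHS](bigD1 u) //= -addSn leq_add //.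
    by rewrite ltnNge ltBA.
  apply: leq_sum => w _;
    have [-> // | neqABw] := eqVneq (slice A w) (slice B w).
  by apply: ltnW; rewrite ltnNge ltBA.
have [||||C [x [CF ltC xE xA]]] := rkP (slice A u) (slice B u) => //.
- by rewrite facets_indep; case/andP: (maxA u).
- by rewrite facets_indep; case/andP: (maxB u).
(* Hence the family [F] below, which differs from [B] only at [u], blocks no vertex that [B] leaves
   free. *)
have v0C : v0 \in C -> v0 \in slice B u by apply/rk_v0/ltnW.
pose F w := if w == u then C else slice B w.
have blockedF w : blocked v0 F w -> blocked v0 (slice B) w.
  case/existsP=> z /andP[wz v0F]; apply/existsP; exists z; rewrite wz /=.
  by move: v0F; rewrite /F; case: eqP => // ->.
exists (glue v0 F), (u, x); split.
- rewrite facets_indep max_independent_attach; apply/forallP=> w.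
  have /andP[maxBw avBw] := maxB w.
  apply/andP; split; first by rewrite /F; case: eqP; rewrite // -facets_indep.
  apply: (@avoidingS _ _ (blocked v0 (slice B) w)) => [_|];
    first exact: blockedF.
  rewrite /F; case: eqP avBw => // -> /andP[_ v0B].
  rewrite facets_indep in CF; rewrite /avoiding (maxsetp CF).
  by apply/implyP=> /v0C v0Bu; rewrite v0Bu in v0B.
- rewrite (bigD1 u) //= [ltnRHS](bigD1 u) //= -addSn leq_add //.
    by rewrite slice_glue /F eqxx.
  by apply: leq_sum => w /negbTE wu; rewrite slice_glue /F wu.
- apply/setP=> -[w v]; rewrite in_setD mem_glue in_set1 xpair_eqE /F.
  have [-> | _] := eqVneq w u; last by rewrite inE andNb.
  by rewrite -in_set1 -xE !inE.
- by rewrite inE in xA.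
Qed.

End Sufficiency.

Theorem theorem1p2 (H : sgraph) (v0 : H) :
  (forall G : sgraph, well_covered (attach G v0) /\ shellable (attach G v0)) <->
  (well_covered H /\
   (shellable H /\ shellable (del_vertex v0)) /\
   (forall tau : {set del_vertex v0}, max_independent tau ->
      exists2 v : del_vertex v0, v \in tau & edge v0 (val v))).
Proof.
split=> [attachP | [wcH [[shH shD] edgeP]] G].
  have [wc1 sh1] := attachP point; have [wc3 sh3] := attachP path3.
  split; first exact: well_covered_point wc1.
  split; last exact: well_covered_edge wc3.
  by split; [apply: shellable_point sh1 | apply: shellable_path3 sh3].
have avoiding_max (X : {set H}) :
  maxset (avoiding v0 true) X -> max_independent X.
  move=> maxX; have v0X : v0 \notin X by rewrite (maxset_avoiding_notin maxX).
  have [|v vX v0v] := edgeP (val @^-1: X).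
    by rewrite max_independent_del imset_val_preim.
  rewrite inE in vX; have /andP[indX _] := maxsetp maxX.
  apply/maxsetP; split=> // Y indY XY; apply: (maxsetsup maxX) => //.
  rewrite /avoiding indY /= implybF; apply/negP=> v0Y.
  (* An independent set containing [X] cannot contain [v0], as [X] holds a neighbour of [v0]. *)
  by have := independentP _ indY _ _ v0Y (subsetP XY _ vX); rewrite v0v.
split; first exact: well_covered_attach.
exact: shellable_attach.
Qed.
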